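(* Let $N_1,N_2$ be independent Poisson random variables with mean one, put $x_1=(-2,-2)$, $x_2=(-2,-1)$ in $\mathbb{R}^2$, and define $$X=N_1x_1+N_2x_2-(x_1+x_2).$$ Then the covariance matrix $\Sigma$ of $X$ is positive definite, but for $t_1=(-2,1)$ and $t_2=(-1,2)$ one has $$C_X(t_1)=\frac{35}{39},\qquad C_X(t_2)=0,\qquad C_X(t_1+t_2)=1.$$ Consequently, $C_X(t_1+t_2)>C_X(t_1)+C_X(t_2)$.
   Context: For a centered infinitely divisible random vector $X$ in $\mathbb{R}^d$ with finite second moment and covariance matrix $\Sigma$, put $K_X(t):=\log\mathbb{E}e^{\langle t,X\rangle}$ (value $+\infty$ allowed) and $V_X(t):=t^\top\Sigma t$. Directional (radial) pole: if $V_X(t)>0$, $C_X(t)\in[0,\infty]$ is the infimum of all $c\in[0,\infty)$ such that $$K_X(st)\le\frac{V_X(t)s^2}{2(1-cs)}\qquad\text{for all }0\le s<1/c,$$ with $1/0=\infty$ and $\inf\emptyset=\infty$. If $V_X(t)=0$, $C_X(t):=0$. *)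

(* Defs.v *)
From HB Require Import structures.
From mathcomp Require Import all_boot all_order all_algebra.
From mathcomp Require Import all_classical all_reals all_analysis.
Import Order.TTheory GRing.Theory Num.Theory.
Import numFieldNormedType.Exports.

Set Implicit Arguments.
Unset Strict Implicit.
Unset Printing Implicit Defensive.

Local Open Scope classical_set_scope.
Local Open Scope ring_scope.

(* The library's [poisson_prob rate k] ignores its argument [k : nat];
   [0%N] is a dummy. *)
Definition is_poisson {d} {T : measurableType d} {R : realType}
    (P : probability T R) (rate : R) (N : {RV P >-> nat}) : Prop :=
  forall A : set nat, distribution P N A = poisson_prob rate 0%N A.

Definition independent_RV2 {d d1 d2} {T : measurableType d}
    {T1 : measurableType d1} {T2 : measurableType d2} {R : realType}
    (P : probability T R) (X : {RV P >-> T1}) (Y : {RV P >-> T2}) : Prop :=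
  forall (A : set T1) (B : set T2), measurable A -> measurable B ->
    P (X @^-1` A `&` Y @^-1` B) = (P (X @^-1` A) * P (Y @^-1` B))%E.

Definition vec2 {R : realType} (a b : R) : 'cV[R]_2 :=
  \col_(i < 2) [:: a; b]`_i.

Definition dotcv {R : realType} {n : nat} (u v : 'cV[R]_n) : R :=
  (u^T *m v) 0 0.

Definition posdefmx {R : realType} {n : nat} (A : 'M[R]_n) : Prop :=
  A^T = A /\ forall v : 'cV[R]_n, v != 0 -> 0 < dotcv v (A *m v).

Section radial_pole.
Context {d : measure_display} {T : measurableType d} {R : realType}.
Context {n : nat} (P : probability T R) (X : T -> 'cV[R]_n).
Implicit Type t : 'cV[R]_n.

(* [fine] loses nothing when X has finite second moments. *)
Definition covmx : 'M[R]_n :=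
  \matrix_(i, j) fine (covariance P (fun w => X w i 0) (fun w => X w j 0)).

Definition log_laplace t : \bar R :=
  lne ('E_P[fun w => expR (dotcv t (X w))])%E.

Definition dir_var t : R := dotcv t (covmx *m t).

(* The inverse in [s%:E < (c%:E)^-1] is taken in [\bar R], where [0^-1 = +oo];
   [ereal_inf set0 = +oo]. *)
Definition radial_pole t : \bar R :=
  if dir_var t == 0 then 0%:E else
  ereal_inf [set c%:E | c in [set c : R | 0 <= c /\
    forall s : R, 0 <= s -> (s%:E < (c%:E)^-1)%E ->
      (log_laplace (s *: t)
        <= (dir_var t * s ^+ 2 / (2 * (1 - c * s)))%:E)%E]].

End radial_pole.

(* Main.v *)
Require Import Defs.
From HB Require Import structures.
From mathcomp Require Import all_boot all_order all_algebra.
From mathcomp Require Import all_classical all_reals all_analysis.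
From mathcomp Require Import measurable_realfun ring lra.
Import Order.TTheory GRing.Theory Num.Theory.
Import numFieldNormedType.Exports.

Set Implicit Arguments.
Unset Strict Implicit.
Unset Printing Implicit Defensive.

Local Open Scope classical_set_scope.
Local Open Scope ring_scope.

(** The cumulant generating function of [X] is [g <t, x1> + g <t, x2>] with
    [g u = e^u - 1 - u], and its variance form is [<t, x1>^2 + <t, x2>^2].
    Comparing third-order Taylor coefficients at [s = 0] shows that an admissible
    [c] satisfies [x^3 + y^3 <= 3 c (x^2 + y^2)] for [x = <t, x1>], [y = <t, x2>].
    When [x] and [y] are nonnegative and at most [4 c], this single inequality is
    also sufficient, since the later Taylor coefficients have ratios at most
    [max x y / 4].  For [t1] one has [(x, y) = (2, 3)], for [t1 + t2] one has
    [(x, y) = (0, 3)], and for [t2] one has [(x, y) = (-2, 0)], where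
    [g u <= u^2 / 2] on the negative half-line makes [c = 0] admissible. *)

(** * Taylor bounds for the exponential *)

Lemma series_exp_coeff_le (R : realType) (x : R) (n : nat) :
  0 <= x -> series (exp_coeff x) n <= expR x.
Proof.
move=> x0; apply: nondecreasing_cvgn_le; last exact: is_cvg_series_exp_coeff.
by apply/nondecreasing_seqP => k; rewrite !seriesEnat /= big_nat_recr//= lerDl exp_coeff_ge0.
Qed.

Lemma exp_coeffS (R : realType) (x : R) (n : nat) :
  exp_coeff x n.+1 = exp_coeff x n * x / n.+1%:R.
Proof.
rewrite /exp_coeff /= exprSr factS natrM invfM; ring.
Qed.

Lemma series_exp_coeff4 (R : realType) (x : R) :
  series (exp_coeff x) 4%N = 1 + x + x ^+ 2 / 2 + x ^+ 3 / 6.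
Proof.
rewrite seriesEnat /= !big_nat_recr//= big_geq//.
by rewrite /exp_coeff /= !factS fact0 expr0 expr1 !muln1 divr1 divr1 add0r.
Qed.

Lemma expR_ge_cubic (R : realType) (x : R) :
  0 <= x -> 1 + x + x ^+ 2 / 2 + x ^+ 3 / 6 <= expR x.
Proof. by move=> x0; rewrite -series_exp_coeff4 series_exp_coeff_le. Qed.

(** Multiply by [expR x] and insert its cubic lower bound: the product with the right-hand side is
    at least [1 + x^3/6 + x^4/12 + x^5/12]. *)
Lemma expRN_le_quadratic (R : realType) (x : R) :
  0 <= x -> expR (- x) <= 1 - x + x ^+ 2 / 2.
Proof.
move=> x0; rewrite expRN -[leLHS]mul1r ler_pdivrMr ?expR_gt0//.
have := expR_ge_cubic x0; have := exprn_ge0 3 x0; have := sqr_ge0 (x ^+ 2).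
have : 0 <= 1 - x + x ^+ 2 / 2 by have := sqr_ge0 (x - 1); nra.
nra.
Qed.

Definition expR_rem2 {R : realType} (x : R) : R := expR x - 1 - x.

(* The Taylor coefficients [a_n] of [expR_rem2 (s x) + expR_rem2 (s y)] satisfy
   [a_(n+1) <= c a_n], so that multiplying the series by [1 - c s] leaves no positive
   coefficient beyond the quadratic one; here [s] is absorbed in [x], [y], [c]. *)
Lemma expR_rem2D_le (R : realType) (c x y : R) :
  0 <= c < 1 -> 0 <= x <= 4 * c -> 0 <= y <= 4 * c ->
  x ^+ 3 + y ^+ 3 <= 3 * c * (x ^+ 2 + y ^+ 2) ->
  expR_rem2 x + expR_rem2 y <= (x ^+ 2 + y ^+ 2) / (2 * (1 - c)).
Proof.
move=> /andP[c0 c1] /andP[x0 xc] /andP[y0 yc] h3.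
pose S n := series (exp_coeff x) n + series (exp_coeff y) n.
(* The ratio of these two coefficients is [z / (n + 4)], hence at most [4 c / 4]. The ratio of the
   cubic to the quadratic terms is governed by [h3] instead. *)
have step (z : R) n : 0 <= z <= 4 * c ->
    exp_coeff z n.+4 <= c * exp_coeff z n.+3.
  move=> /andP[z0 zc]; rewrite exp_coeffS ler_pdivrMr ?ltr0n//.
  rewrite [leRHS]mulrAC mulrC ler_wpM2r ?exp_coeff_ge0//.
  rewrite (le_trans zc)// mulrC ler_wpM2l// ler_nat//.
(* With [a_k] the sum of the two [k]-th coefficients, the left side telescopes to [a_2] plus the
   terms [a_(k+1) - c a_k], all nonpositive. The second summand compensates the truncation. *)
have H n : (1 - c) * (S n.+4 - 2 - x - y) +
    c * (exp_coeff x n.+3 + exp_coeff y n.+3) <= (x ^+ 2 + y ^+ 2) / 2.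
  elim: n => [|n IH].
    rewrite /S !series_exp_coeff4 /exp_coeff /= !factS fact0 !muln1.
    have -> : (3 * 2 = 6)%N by []. nra.
  apply: le_trans IH.
  have -> : S n.+4.+1 = S n.+4 + exp_coeff x n.+4 + exp_coeff y n.+4.
    have sS (u : R^nat) k : series u k.+1 = series u k + u k.
      by rewrite !seriesEnat /= big_nat_recr.
    by rewrite /S 2!(sS _ n.+4); ring.
  have := step x n; have := step y n. rewrite x0 y0 xc yc => /(_ isT) hx /(_ isT) hy; nra.
have cS : S @ \oo --> expR x + expR y.
  by apply: cvgD; exact: is_cvg_series_exp_coeff.
have : limn S <= (x ^+ 2 + y ^+ 2) / (2 * (1 - c)) + 2 + x + y.
  apply: limr_le; first by apply/cvg_ex; eexists; exact: cS.
  near=> n.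
  have [m ->] : exists m, n = m.+4%N.
    exists (n - 4)%N. rewrite -addn4 subnK//; near: n; exact: nbhs_infty_ge.
  suff : S m.+4 - 2 - x - y <= (x ^+ 2 + y ^+ 2) / (2 * (1 - c)) by lra.
  rewrite ler_pdivlMr; last lra.
  have := H m.
  have : 0 <= c * (exp_coeff x m.+3 + exp_coeff y m.+3).
    by rewrite mulr_ge0// addr_ge0// exp_coeff_ge0.
  nra.
rewrite (cvg_lim _ cS)// /expR_rem2; lra.
Unshelve. all: by end_near. Qed.

(** Clearing the denominator and cancelling [s^3] leaves [W (1 - c s) <= 3 c V]; letting [s] tend to
    0 would conclude. One small explicit [s] replaces the limit. *)
Lemma cubic_pole_le (R : realType) (c V W : R) : 0 <= c -> 0 <= W ->
  (forall s, 0 < s -> c * s < 1 -> V * s ^+ 2 / 2 + W * s ^+ 3 / 6 <=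
     V * s ^+ 2 / (2 * (1 - c * s))) ->
  W <= 3 * c * V.
Proof.
move=> c0 W0 h; rewrite leNgt; apply/negP => hlt.
pose dl := W - 3 * c * V.
have dl0 : 0 < dl by rewrite /dl; lra.
have D0 : 0 < 1 + c * (W + dl) by rewrite ltr_wpDr// mulr_ge0// addr_ge0// ltW.
(* A contradiction needs [c s < 1] and [c s W < dl]. This denominator secures both, also when [c] or
   [W] vanishes. *)
pose s := dl / (1 + c * (W + dl)).
have s0 : 0 < s by rewrite divr_gt0.
have sE : s * (1 + c * (W + dl)) = dl by rewrite divfK// gt_eqF.
have cs : c * s < 1.
  by rewrite /s mulrA ltr_pdivrMr// mul1r; nra.
have cs' : c * s * W < dl by nra.
have := h s s0 cs; rewrite ler_pdivlMr; last lra.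
have -> : (V * s ^+ 2 / 2 + W * s ^+ 3 / 6) * (2 * (1 - c * s)) =
   s ^+ 2 * ((V + W * s / 3) * (1 - c * s)) by field.
rewrite [leRHS]mulrC ler_pM2l ?exprn_gt0// => h'.
have : s * (W * (1 - c * s)) <= s * (3 * c * V) by lra.
rewrite ler_pM2l// /dl in cs' *; lra.
Qed.

(** * Independence and moments of mean-one Poisson variables *)

(** The law of the pair agrees with the product of the laws on rectangles, hence everywhere; Tonelli
    then factors the integral, with nonnegativity in place of integrability. *)
Lemma independent_expectationM (R : realType) (d d1 d2 : measure_display)
    (T : measurableType d) (T1 : measurableType d1) (T2 : measurableType d2)
    (P : probability T R) (X : {RV P >-> T1}) (Y : {RV P >-> T2})
    (f : T1 -> R) (g : T2 -> R) :
  independent_RV2 X Y -> measurable_fun setT f -> measurable_fun setT g ->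
  (forall x, 0 <= f x) -> (forall y, 0 <= g y) ->
  'E_P[fun w => (f (X w) * g (Y w))%R]%E = ('E_P[f \o X] * 'E_P[g \o Y])%E.
Proof.
move=> indXY mf mg f0 g0.
have mXY : measurable_fun setT (fun w => (X w, Y w)) by exact: measurable_fun_pair.
pose mXY_mixin := isMeasurableFun.Build _ _ _ _ _ mXY.
pose XY : {mfun T >-> (T1 * T2)%type} := HB.pack (fun w => (X w, Y w)) mXY_mixin.
pose h (z : T1 * T2) : \bar R := (f z.1 * g z.2)%:E.
have mh : measurable_fun setT h.
  apply/measurable_EFinP; apply: measurable_funM; exact: measurableT_comp.
have h0 z : (0 <= h z)%E by rewrite lee_fin mulr_ge0.
rewrite !unlock.
transitivity (\int[distribution P XY]_z h z)%E.
  by rewrite ge0_integral_distribution.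
transitivity (\int[distribution P X \x distribution P Y]_z h z)%E.
  apply: eq_measure_integral => A mA _; apply/esym.
  by apply: product_measure_unique => // B C mB mC; exact: indXY.
have mEf : measurable_fun setT (EFin \o f) by exact/measurable_EFinP.
have mEg : measurable_fun setT (EFin \o g) by exact/measurable_EFinP.
rewrite fubini_tonelli1//= /fubini_F /h /=.
under eq_integral => x _.
  under eq_integral => y _ do rewrite EFinM.
  rewrite ge0_integralZl//; [|by move=> y _; rewrite lee_fin|by rewrite lee_fin].
  over.
rewrite ge0_integralZr//; [|by move=> x _; rewrite lee_fin|].
  by rewrite !ge0_integral_distribution// => z; rewrite lee_fin.
by apply: integral_ge0 => y _; rewrite lee_fin.
Qed.

Section poisson1_moments.
Context (R : realType) (d : measure_display) (T : measurableType d).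
Context (P : probability T R).
Implicit Types (N : {RV P >-> nat}) (f : nat -> R).

Lemma measurable_natRV N f : measurable_fun setT (fun w => f (N w)).
Proof. by apply: (measurableT_comp (f := f) _ (measurable_funP N)). Qed.

Lemma ge0_expectation_nat N f :
  (forall k, 0 <= f k) ->
  'E_P[f \o N]%E = (\sum_(k <oo) (f k)%:E * distribution P N [set k])%E.
Proof.
move=> f0; rewrite unlock.
have mN k : measurable (N @^-1` [set k]) by apply: measurable_funPTI.
have UN : \bigcup_k N @^-1` [set k] = [set: T].
  by apply/seteqP; split => // w _; exists (N w).
rewrite -UN ge0_integral_bigcup//; first last.
- by move=> i j _ _ [w [/= -> ->]].
- by move=> w _; rewrite lee_fin /=.
- rewrite UN; apply/measurable_EFinP; exact: measurableT_comp.
apply: eq_eseriesr => k _.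
rewrite (eq_integral (cst (f k)%:E)); last by move=> w; rewrite inE /= => ->.
by rewrite integral_cst.
Qed.

Lemma poisson1_expectation N f : is_poisson 1 N -> (forall k, 0 <= f k) ->
  'E_P[f \o N]%E = (\sum_(k <oo) (f k * (k`!%:R^-1 * expR (- 1)))%:E)%E.
Proof.
move=> hN f0; rewrite ge0_expectation_nat//; apply: eq_eseriesr => k _.
by rewrite hN /poisson_prob ltr01 esum_set1/= ?lee_fin ?poisson_pmf_ge0//
  /poisson_pmf ltr01 expr1n mul1r EFinM.
Qed.

(* The Chen-Stein identity, from which the first two moments are read off. *)
Lemma poisson1_expectation_natM N f : is_poisson 1 N -> (forall k, 0 <= f k) ->
  ('E_P[fun w => ((N w)%:R * f (N w))%R] = 'E_P[fun w => f (N w).+1])%E.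
Proof.
move=> hN f0; pose p k : R := k`!%:R^-1 * expR (- 1).
have p0 k : 0 <= p k by rewrite mulr_ge0 ?expR_ge0.
rewrite (poisson1_expectation (f := fun k => k%:R * f k))//; last first.
  by move=> k; rewrite mulr_ge0.
rewrite (poisson1_expectation (f := f \o S))//; last by move=> k /=.
rewrite nneseries_recl//; last by move=> k _; rewrite lee_fin !mulr_ge0.
rewrite !mul0r add0e -nneseries_addn; last by move=> k; rewrite lee_fin !mulr_ge0.
apply: eq_eseriesr => k _; rewrite addn1 /= factS natrM invfM; congr EFin.
by rewrite !mulrA (mulrC k.+1%:R) mulfK ?pnatr_eq0.
Qed.

(** The sum is [expR (- 1 - a)] times the exponential series at [expR a]. *)
Lemma poisson1_expectation_expR N (a : R) :
  is_poisson 1 N ->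
  'E_P[fun w => expR ((N w)%:R * a - a)%R]%E = (expR (expR a - 1 - a))%:E.
Proof.
move=> hN.
rewrite (poisson1_expectation (f := fun k => expR (k%:R * a - a)))//.
transitivity (\sum_(k <oo) (expR (- 1 - a))%:E * (exp_coeff (expR a) k)%:E)%E.
  apply: eq_eseriesr => k _; rewrite -EFinM; congr EFin.
  by rewrite /exp_coeff /= !expRD expRM_natl; ring.
rewrite nneseriesZl//; last by move=> k _; rewrite lee_fin exp_coeff_ge0 ?expR_ge0.
rewrite (_ : expR a - 1 - a = - 1 - a + expR a); last by ring.
rewrite [in RHS]expRD EFinM; congr *%E.
rewrite /expR -EFin_lim; last exact: is_cvg_series_exp_coeff.
by apply/congr_lim/funext => n /=; rewrite sumEFin.
Qed.

Lemma poisson1_expectation_id N :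
  is_poisson 1 N -> 'E_P[fun w => (N w)%:R]%E = 1%:E.
Proof.
move=> hN; have := poisson1_expectation_natM (f := cst 1) hN (fun=> ler01).
by under eq_fun do rewrite mulr1; rewrite expectation_cst.
Qed.

Lemma poisson1_expectation_sqr N :
  is_poisson 1 N -> 'E_P[fun w => ((N w)%:R ^+ 2)%R]%E = 2%:E.
Proof.
(* Chen-Stein with the identity function: the second moment is the mean of [N + 1]. *)
move=> hN; have := poisson1_expectation_natM hN (fun k => ler0n R k).
under eq_fun do rewrite -expr2.
move=> ->.
have EN := poisson1_expectation_id hN.
rewrite unlock in EN *.
under eq_integral => w _ do rewrite -natr1 EFinD.
rewrite ge0_integralD//.
- rewrite EN -[X in (_ + X)%E]/(\int[P]_w (cst 1%E w))%E integral_cst//=.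
  by rewrite probability_setT mule1.
- by apply/measurable_EFinP; exact: (measurable_natRV _ (fun k => k%:R)).
Qed.

Lemma poisson1_Lfun2 N :
  is_poisson 1 N -> (fun w => (N w)%:R) \in Lfun P 2%:E.
Proof.
move=> hN; rewrite inE; apply/andP; split; rewrite inE /=.
  exact: (measurable_natRV _ (fun k => k%:R)).
rewrite /finite_norm unlock /= poweR_lty//.
have := poisson1_expectation_sqr hN; rewrite unlock.
under eq_integral => w _ do rewrite -[(N w)%:R]ger0_norm// -powR_mulrn//.
by move=> ->; rewrite ltry.
Qed.

End poisson1_moments.

(** * Scalar products, the range of [s], and bilinearity of covariance *)

Lemma dotcvZl (R : realType) (n : nat) (s : R) (t x : 'cV[R]_n) :
  dotcv (s *: t) x = s * dotcv t x.
Proof. by rewrite /dotcv linearZ /= -scalemxAl mxE. Qed.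

(** Turns the range of [s] in [radial_pole] into a real inequality; at [c = 0] both sides hold. *)
Lemma lte_inve (R : realType) (c s : R) : 0 <= c -> 0 <= s ->
  (s%:E < (c%:E)^-1)%E = (c * s < 1).
Proof.
move=> c0 s0; rewrite inver; case: eqP => [->|/eqP cn0].
  by rewrite ltry mul0r ltr01.
by rewrite lte_fin -[c^-1]mul1r ltr_pdivlMr 1?mulrC// lt_neqAle eq_sym cn0.
Qed.

Lemma dotcv_vec2 (R : realType) (a b a' b' : R) :
  dotcv (vec2 a b) (vec2 a' b') = a * a' + b * b'.
Proof. by rewrite /dotcv mxE !big_ord_recl big_ord0 addr0 !mxE. Qed.

Lemma covariance_affine (R : realType) (d : measure_display)
    (T : measurableType d) (P : probability T R) (X Y : T -> R)
    (a b c a' b' c' : R) :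
  X \in Lfun P 2%:E -> Y \in Lfun P 2%:E ->
  covariance P X X = 1%:E -> covariance P Y Y = 1%:E ->
  covariance P X Y = 0%:E ->
  covariance P (fun w => X w * a + Y w * b - c) (fun w => X w * a' + Y w * b' - c')
    = (a * a' + b * b')%:E.
Proof.
move=> X2 Y2 XX YY XY.
have Pfin : P setT \is a fin_num := fin_num_measure P _ measurableT.
have l12 : (1 <= 2 :> R) by rewrite ler1n.
(* Closure properties of the Lebesgue spaces, kept in context so that [auto] discharges the
   integrability conditions of the covariance rules. *)
have L1 (f : T -> R) : f \in Lfun P 2%:E -> f \in Lfun P 1 :=
  @Lfun_subset12 _ _ _ P Pfin f.
have LZ (k : R) f : f \in Lfun P 2%:E -> k \o* f \in Lfun P 2%:E.
  by move=> f2; exact: Lfun_scale.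
have LC (k : R) : cst k \in Lfun P 2%:E by exact: Lfun_cst.
have LD f g : f \in Lfun P 2%:E -> g \in Lfun P 2%:E -> f \+ g \in Lfun P 2%:E.
  by move=> f2 g2; rewrite rpredD ?lee1n.
have LB f g : f \in Lfun P 2%:E -> g \in Lfun P 2%:E -> f \- g \in Lfun P 2%:E.
  by move=> f2 g2; rewrite rpredB ?lee1n.
have LM f g : f \in Lfun P 2%:E -> g \in Lfun P 2%:E -> f * g \in Lfun P 1.
  by move=> f2 g2; exact: Lfun2_mul_Lfun1.
rewrite -[X in covariance P X]/((a \o* X \+ b \o* Y) \- cst c).
rewrite -[X in covariance P _ X]/((a' \o* X \+ b' \o* Y) \- cst c').
rewrite covarianceBl ?covarianceBr ?covariance_cst_l ?covariance_cst_r ?sube0;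
  do ?[by auto].
rewrite covarianceDl ?covarianceDr; do ?[by auto].
rewrite !covarianceZl ?covarianceZr; do ?[by auto].
rewrite (covarianceC P Y X) XX YY XY !mule0 !mule1 adde0 add0e.
by rewrite -!EFinM -EFinD.
Qed.

(** * Covariance, cumulants and poles of a centered Poisson pair *)

Section poisson_pair.
Context (R : realType) (d : measure_display) (T : measurableType d).
Context (P : probability T R) (N1 N2 : {RV P >-> nat}).
Context (hN1 : is_poisson 1 N1) (hN2 : is_poisson 1 N2).
Context (hind : independent_RV2 N1 N2).
Context (n : nat) (x1 x2 : 'cV[R]_n).

Local Notation X :=
  (fun w => (N1 w)%:R *: x1 + (N2 w)%:R *: x2 - (x1 + x2)).

(** Coordinates of [X] are affine in [N1] and [N2], which are uncorrelated with variance
    [2 - 1 = 1]. *)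
Lemma covmx_poisson_pair : covmx P X = x1 *m x1^T + x2 *m x2^T.
Proof.
have Pfin : P setT \is a fin_num := fin_num_measure P _ measurableT.
have var1 (N : {RV P >-> nat}) : is_poisson 1 N ->
    covariance P (fun w => (N w)%:R) (fun w => (N w)%:R) = 1%:E.
  move=> hN; have N2' := poisson1_Lfun2 hN.
  rewrite covarianceE ?Lfun2_mul_Lfun1 ?Lfun_subset12//.
  rewrite -expr2 [X in ('E_P[X])%E](_ : _ = fun w => (N w)%:R ^+ 2); last first.
    by apply/funext.
  rewrite poisson1_expectation_sqr// poisson1_expectation_id//.
  by rewrite mule1 -EFinB; congr EFin; ring.
have cov0 : covariance P (fun w => (N1 w)%:R) (fun w => (N2 w)%:R) = 0%:E.
  have L1 := poisson1_Lfun2 hN1.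
  have L2 := poisson1_Lfun2 hN2.
  rewrite covarianceE ?Lfun2_mul_Lfun1 ?Lfun_subset12//.
  have -> := independent_expectationM (f := fun k => k%:R) (g := fun k => k%:R) hind => //.
  by rewrite !poisson1_expectation_id// mule1 subee.
apply/matrixP => i j; rewrite !mxE !big_ord1 !mxE.
have -> : (fun w => X w i 0) = fun w =>
    (N1 w)%:R * x1 i 0 + (N2 w)%:R * x2 i 0 - (x1 i 0 + x2 i 0).
  by apply/funext => w; rewrite !mxE.
have -> : (fun w => X w j 0) = fun w =>
    (N1 w)%:R * x1 j 0 + (N2 w)%:R * x2 j 0 - (x1 j 0 + x2 j 0).
  by apply/funext => w; rewrite !mxE.
by rewrite covariance_affine ?poisson1_Lfun2 ?var1.
Qed.

Lemma dir_var_poisson_pair t :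
  dir_var P X t = dotcv t x1 ^+ 2 + dotcv t x2 ^+ 2.
Proof.
rewrite /dir_var covmx_poisson_pair /dotcv mulmxDl mulmxDr mxE.
have E (x : 'cV[R]_n) : (t^T *m (x *m x^T *m t)) 0 0 = ((t^T *m x) 0 0) ^+ 2.
  rewrite !mulmxA -mulmxA mxE big_ord1 expr2; congr (_ * _).
  by rewrite -[x in RHS]trmxK -trmx_mul [RHS]mxE.
by rewrite !E.
Qed.

Lemma log_laplace_poisson_pair t :
  log_laplace P X t = (expR_rem2 (dotcv t x1) + expR_rem2 (dotcv t x2))%:E.
Proof.
rewrite /log_laplace.
have -> : (fun w => expR (dotcv t (X w))) = fun w =>
    expR ((N1 w)%:R * dotcv t x1 - dotcv t x1) *
    expR ((N2 w)%:R * dotcv t x2 - dotcv t x2).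
  apply/funext => w; rewrite -expRD; congr expR.
  by rewrite /dotcv mulmxBr !mulmxDr -!scalemxAr !mxE; ring.
have -> := independent_expectationM
  (f := fun k => expR (k%:R * dotcv t x1 - dotcv t x1))
  (g := fun k => expR (k%:R * dotcv t x2 - dotcv t x2)) hind => //.
rewrite !poisson1_expectation_expR// -EFinM -expRD lne_EFin ?expR_gt0//.
by rewrite expRK.
Qed.

(** Equality in the cubic condition pins the pole: [expR_rem2D_le] makes [c] admissible, and
    [cubic_pole_le] bounds every admissible constant below by [c]. *)
Lemma radial_pole_poisson_pair t (c : R) :
  let x := dotcv t x1 in let y := dotcv t x2 in
  0 <= x <= 4 * c -> 0 <= y <= 4 * c -> x ^+ 2 + y ^+ 2 != 0 ->
  x ^+ 3 + y ^+ 3 = 3 * c * (x ^+ 2 + y ^+ 2) ->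
  radial_pole P X t = c%:E.
Proof.
move=> x y hx hy V0 hc; have c0 : 0 <= c by lra.
rewrite /radial_pole dir_var_poisson_pair -/x -/y (negbTE V0).
apply/eqP; rewrite eq_le; apply/andP; split.
  apply: ereal_inf_lbound; exists c => //; split => // s s0.
  rewrite lte_inve// => cs; rewrite log_laplace_poisson_pair !dotcvZl -/x -/y lee_fin.
  rewrite (_ : _ * s ^+ 2 = (s * x) ^+ 2 + (s * y) ^+ 2); last by ring.
  case/andP: hx hy => x0 xc /andP[y0 yc].
  (* Applied to [s x], [s y], [c s]: both sides of the cubic condition scale by [s^3]. *)
  apply: expR_rem2D_le.
  - by rewrite cs mulr_ge0.
  - by rewrite mulr_ge0//= mulrA [leRHS]mulrC ler_wpM2l.
  - by rewrite mulr_ge0//= mulrA [leRHS]mulrC ler_wpM2l.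
  - rewrite !exprMn -!mulrDr hc.
    by rewrite le_eqVlt; apply/orP; left; apply/eqP; ring.
apply: le_ereal_inf_tmp => _ [c' [c'0 h] <-]; rewrite lee_fin.
have V1 : 0 < x ^+ 2 + y ^+ 2 by rewrite lt_neqAle eq_sym V0 addr_ge0 ?sqr_ge0.
have : x ^+ 3 + y ^+ 3 <= 3 * c' * (x ^+ 2 + y ^+ 2).
  apply: cubic_pole_le => //.
    by rewrite addr_ge0// exprn_ge0; lra.
  move=> s s0 cs.
  have sx : 0 <= s * x by rewrite mulr_ge0 ?(ltW s0)//; lra.
  have sy : 0 <= s * y by rewrite mulr_ge0 ?(ltW s0)//; lra.
  have := h s (ltW s0); rewrite lte_inve ?(ltW s0)// => /(_ cs).
  rewrite log_laplace_poisson_pair !dotcvZl lee_fin; apply: le_trans.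
  have := expR_ge_cubic sx; have := expR_ge_cubic sy.
  rewrite /expR_rem2 -/x -/y !exprMn; lra.
rewrite hc ler_pM2r//; lra.
Qed.

Lemma radial_pole_poisson_pair_le0 t :
  dotcv t x1 <= 0 -> dotcv t x2 <= 0 -> radial_pole P X t = 0%:E.
Proof.
move=> hx hy; rewrite /radial_pole; case: ifP => // _.
apply/eqP; rewrite eq_le; apply/andP; split; last first.
  by apply: le_ereal_inf_tmp => _ [c' [c'0 _] <-]; rewrite lee_fin.
apply: ereal_inf_lbound; exists 0 => //; split => // s s0 _.
rewrite dir_var_poisson_pair log_laplace_poisson_pair !dotcvZl lee_fin /expR_rem2.
have := @expRN_le_quadratic R (- (s * dotcv t x1)).
have := @expRN_le_quadratic R (- (s * dotcv t x2)).
rewrite !oppr_ge0 !mulr_ge0_le0// !opprK !sqrrN => /(_ isT) h1 /(_ isT) h2.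
by rewrite mul0r subr0 mulr1; lra.
Qed.

End poisson_pair.

(** * The explicit planar example *)

Theorem proposition4p1 (R : realType) (d : measure_display)
    (T : measurableType d) (P : probability T R) (N1 N2 : {RV P >-> nat})
    (hN1 : is_poisson (1 : R) N1) (hN2 : is_poisson (1 : R) N2)
    (hind : independent_RV2 N1 N2) :
  let x1 : 'cV[R]_2 := vec2 (- 2) (- 2) in
  let x2 : 'cV[R]_2 := vec2 (- 2) (- 1) in
  let X : T -> 'cV[R]_2 := fun w =>
    (N1 w)%:R *: x1 + (N2 w)%:R *: x2 - (x1 + x2) in
  let t1 : 'cV[R]_2 := vec2 (- 2) 1 in
  let t2 : 'cV[R]_2 := vec2 (- 1) 2 in
  posdefmx (covmx P X) /\
  radial_pole P X t1 = (35 / 39)%:E /\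
  radial_pole P X t2 = 0%:E /\
  radial_pole P X (t1 + t2) = 1%:E /\
  (radial_pole P X t1 + radial_pole P X t2 < radial_pole P X (t1 + t2))%E.
Proof.
move=> x1 x2 X t1 t2.
(* Here [35 / 39 = (2^3 + 3^3) / (3 (2^2 + 3^2))], and [3 <= 4 * 35 / 39]. *)
have pole1 : radial_pole P X t1 = (35 / 39)%:E.
  by apply: radial_pole_poisson_pair => //; rewrite !dotcv_vec2 ?gt_eqF//; lra.
have pole2 : radial_pole P X t2 = 0%:E.
  by apply: radial_pole_poisson_pair_le0 => //; rewrite dotcv_vec2; lra.
(* Now [3^3 / (3 * 3^2) = 1], and [3 <= 4]. *)
have pole12 : radial_pole P X (t1 + t2) = 1%:E.
  have -> : t1 + t2 = vec2 (- 3) 3.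
    by apply/matrixP => i j; rewrite !mxE; case: i => [[|[|//]] ?] /=; ring.
  by apply: radial_pole_poisson_pair => //; rewrite !dotcv_vec2 ?gt_eqF//; lra.
split; last first.
  by rewrite pole1 pole2 pole12 -EFinD lte_fin; do !split; lra.
split; first by rewrite covmx_poisson_pair// linearD /= !trmx_mul !trmxK.
move=> v v0; rewrite -/(dir_var P X v) dir_var_poisson_pair//.
(* A sum of two squares vanishes only if [v] is orthogonal to both [x1] and [x2], which are linearly
   independent. *)
rewrite lt_neqAle addr_ge0 ?sqr_ge0// andbT eq_sym paddr_eq0 ?sqr_ge0//.
rewrite !sqrf_eq0; apply: contra v0 => /andP[/eqP e1 /eqP e2].
have vE : v = vec2 (v 0 0) (v 1 0).
  by apply/matrixP => i j; rewrite !mxE ord1; case: i => [[|[|//]] ?] /=;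
    congr (v _ _); exact/val_inj.
move: e1 e2; rewrite vE !dotcv_vec2 => e1 e2.
have -> : v 0 0 = 0 by lra.
have -> : v 1 0 = 0 by lra.
by apply/eqP/matrixP => i j; rewrite !mxE; case: i => [[|[|//]] ?].
Qed.
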